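(* Let $$A_1=\begin{bmatrix}1&0\\1&0\end{bmatrix},\qquad A_2=\begin{bmatrix}0&1\\0&-1\end{bmatrix},$$ and consider the sets of matrices $\mathcal{M}_\gamma=\{\gamma A_1,\gamma A_2\}$ parameterized by a scalar $\gamma<1$. As $\gamma\to 1$, the minimum degree of a common convex polynomial Lyapunov function for $\mathcal{M}_\gamma$ goes to infinity. That is, for every integer $D$ there exists $\gamma_0<1$ such that for every $\gamma\in(\gamma_0,1)$ there is no common convex polynomial Lyapunov function for $\mathcal{M}_\gamma$ of degree at most $D$.
   Context: A common convex polynomial Lyapunov function for a finite set $\mathcal{M}$ of real $2\times 2$ matrices is a convex polynomial $p:\mathbb{R}^2\to\mathbb{R}$ with $p(0)=0$, $p(x)>0$ for all $x\neq 0$, and $p(Ax)<p(x)$ for all $x\neq 0$ and all $A\in\mathcal{M}$. *)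

(* Defs.v *)
From HB Require Import structures.
From mathcomp Require Import all_boot all_order all_algebra.
From mathcomp Require Import mpoly.
From mathcomp Require Import classical_sets reals convex.

Set Implicit Arguments.
Unset Strict Implicit.
Unset Printing Implicit Defensive.

Import Order.TTheory GRing.Theory Num.Theory.

Local Open Scope ring_scope.

Section Lyapunov.
Variable R : realType.

Definition peval (p : {mpoly R[2]}) (x : 'cV[R]_2) : R :=
  p.@[fun i => x i 0].

(* The degree of the zero polynomial is taken to be 0; msize is degree + 1. *)
Definition pdegree (p : {mpoly R[2]}) : nat := (msize p).-1.

(* A finite set of matrices is given by the list M of its elements. *)
Definition common_convex_poly_lyapunov
    (M : seq 'M[R]_2) (p : {mpoly R[2]}) : Prop :=
  [/\ convex_function setT (peval p),
      peval p 0 = 0,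
      forall x : 'cV[R]_2, x != 0 -> 0 < peval p x
    & forall (A : 'M[R]_2) (x : 'cV[R]_2),
        A \in M -> x != 0 -> peval p (A *m x) < peval p x].

(* The matrix with rows (a, b) and (c, d). *)
Definition mx22 (a b c d : R) : 'M[R]_2 :=
  \matrix_(i < 2, j < 2)
    if i == 0 then (if j == 0 then a else b)
    else (if j == 0 then c else d).

Definition A1 : 'M[R]_2 := mx22 1 0 1 0.
Definition A2 : 'M[R]_2 := mx22 0 1 0 (-1).

Definition Mset (gamma : R) : seq 'M[R]_2 := [:: gamma *: A1; gamma *: A2].

End Lyapunov.

(* Main.v *)
(** For gamma = 1 a degenerate (non-strict) convex Lyapunov polynomial p takes
    equal values at (1,1) and (1,-1), hence is constant on the segment joining
    them, hence on the whole line x = 1; but p(1,2) >= p(2,2) >= 2 p(1,1).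
    Quantitatively: for polynomials of bounded degree, values on [0,1] control
    the value at 2.  Along rays through the origin this, with convexity, gives
    p(gamma v) >= (1 - e) p(v) with e = O(1 - gamma); on the line x = 1 it
    bounds p(1,2) - p(1,1) by O(e) p(1,1). *)
Require Import Defs.
From HB Require Import structures.
From mathcomp Require Import all_boot all_order all_algebra.
From mathcomp Require Import mpoly.
From mathcomp Require Import classical_sets reals convex.
From mathcomp Require Import interval_inference ring lra.

Import Order.TTheory GRing.Theory Num.Theory.

Local Open Scope ring_scope.

(** * Extrapolation of bounds on univariate polynomials *)

(** Induction on the nodes: dividing [f - f.[a]] by [X - a] lowers the size bound by one and leaves
    a quotient still bounded at the remaining nodes. [C] does not depend on [f], so it serves all
    polynomials of bounded degree at once. *)
Lemma poly_bound_extrapolation (R : realFieldType) (s : seq R) (c : R) :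
  uniq s ->
  exists2 C : R, 1 <= C & forall (f : {poly R}) (B : R), 0 <= B ->
    (size f <= size s)%N -> (forall x, x \in s -> `|f.[x]| <= B) ->
    `|f.[c]| <= C * B.
Proof.
elim: s => [_|a s IHs /= /andP[as_ us]].
  exists 1 => // f B B0; rewrite leqn0 size_poly_eq0 => /eqP-> _.
  by rewrite horner0 normr0 mul1r.
have [C C1 HC] := IHs us.
have [m m0 Hm] : exists2 m : R, 0 <= m &
    forall x, x \in s -> `|x - a|^-1 <= m.
  exists (\sum_(x <- s) `|x - a|^-1).
    by apply: sumr_ge0 => x _; rewrite invr_ge0.
  move=> x xs; rewrite (big_rem x) //= lerDl.
  by apply: sumr_ge0 => y _; rewrite invr_ge0.
(* Comes from [|f.[c]| <= |f.[a]| + |c - a| * |g.[c]|], the quotient [g] being at most [2 * B * m]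
   at the nodes of [s]. *)
exists (1 + `|c - a| * C * m * 2).
  by rewrite lerDl !mulr_ge0 // (le_trans ler01).
move=> f B B0 sf Hf.
have fa : `|f.[a]| <= B by apply: Hf; rewrite mem_head.
have /factor_theorem [g fg] : root (f - f.[a]%:P) a.
  by rewrite /root !hornerE subrr.
have fE x : f.[x] = f.[a] + g.[x] * (x - a).
  have := congr1 (horner^~ x) fg; rewrite !hornerE => H.
  by rewrite -H addrC subrK.
have sg : (size g <= size s)%N.
  have [->|g0] := eqVneq g 0; first by rewrite size_poly0.
  have : (size (f - f.[a]%:P)%R <= (size s).+1)%N.
    apply: leq_trans (size_polyD _ _) _; rewrite geq_max sf size_polyN.
    by apply: leq_trans (size_polyC_leq1 _) _.
  by rewrite fg size_Mmonic ?monicXsubC // size_XsubC addn2.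
have gx x : x \in s -> `|g.[x]| <= 2 * B * m.
  move=> xs.
  have xa : x - a != 0.
    by rewrite subr_eq0; apply: contraNneq as_ => <-.
  have -> : g.[x] = (f.[x] - f.[a]) / (x - a).
    by rewrite fE addrAC subrr add0r mulfK.
  rewrite normrM normfV ler_pM ?invr_ge0 ?Hm //.
  apply: le_trans (ler_normB _ _) _.
  have := Hf x; rewrite inE xs orbT => /(_ isT); lra.
have := HC g (2 * B * m); rewrite !mulr_ge0 // => /(_ isT sg gx) gc.
rewrite fE mulrDl mul1r; apply: le_trans (ler_normD _ _) _.
apply: lerD => //; rewrite normrM mulrC.
apply: le_trans (ler_wpM2l (normr_ge0 _) gc) _.
by rewrite le_eqVlt; apply/orP; left; apply/eqP; ring.
Qed.

Lemma poly_bound_unit_interval (R : realFieldType) (n : nat) (c : R) :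
  exists2 C : R, 1 <= C & forall (f : {poly R}) (B : R), 0 <= B ->
    (size f <= n)%N -> (forall x, 0 <= x <= 1 -> `|f.[x]| <= B) ->
    `|f.[c]| <= C * B.
Proof.
(* For [n = 0] the list is empty, so no division by zero arises. *)
pose s : seq R := [seq i%:R / n%:R | i <- iota 0 n].
have us : uniq s.
  rewrite map_inj_in_uniq ?iota_uniq // => i j.
  rewrite mem_iota /= add0n => ltin _.
  have n0 : n%:R != 0 :> R by rewrite pnatr_eq0 -lt0n (leq_ltn_trans _ ltin).
  by move/(mulIf (invr_neq0 n0))/eqP; rewrite eqr_nat => /eqP.
have [C C1 HC] := poly_bound_extrapolation R s c us.
exists C => // f B B0 sf Hf; apply: HC => //.
  by rewrite size_map size_iota.
move=> x /mapP[i]; rewrite mem_iota /= add0n => ltin ->.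
have n0 : 0 < n%:R :> R by rewrite ltr0n (leq_ltn_trans _ ltin).
apply: Hf; rewrite divr_ge0 ?ler0n //= ler_pdivrMr // mul1r ler_nat.
exact: ltnW.
Qed.

(** * Restriction to lines and convexity *)

Lemma meval_line (R : comNzRingType) (k : nat) (p : {mpoly R[k]})
    (x v : 'I_k -> R) :
  exists2 f : {poly R}, (size f <= msize p)%N &
    forall t, f.[t] = p.@[fun i => x i + t * v i].
Proof.
(* Each affine factor has size at most 2, so the monomial [m] contributes size at most
   [mdeg m + 1]. *)
exists (\sum_(m <- msupp p) p@_m *: \prod_i ((x i)%:P + v i *: 'X) ^+ m i).
  apply: leq_trans (size_sum _ _ _) _; apply/bigmax_leqP_seq => m ms _.
  apply: leq_trans (size_scale_leq _ _) _.
  apply: leq_trans _ (msize_mdeg_lt ms); rewrite mdegE.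
  elim/big_rec2: _ => [|i d q _ IH]; first by rewrite size_poly1.
  apply: leq_trans (size_polyMleq _ _) _.
  have H : (size (((x i)%:P + v i *: 'X) ^+ m i)%R <= (m i).+1)%N.
    apply: leq_trans (size_poly_exp_leq _ _) _.
    rewrite ltnS -[leqRHS]mul1n leq_mul2r; apply/orP; right.
    rewrite -ltnS; apply: leq_trans (leqSpred _) _.
    case E : (size _) => [//|j] /=; rewrite -E.
    apply: leq_trans (size_polyD _ _) _; rewrite geq_max.
    rewrite (leq_trans (size_polyC_leq1 _)) //.
    by rewrite (leq_trans (size_scale_leq _ _)) // size_polyX.
  rewrite -subn1 leq_subLR; apply: leq_trans (leq_add H IH) _.
  by rewrite addSn addnS add1n.
move=> t; rewrite mevalE horner_sum; apply: eq_bigr => m _.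
rewrite hornerZ horner_prod; congr (_ * _); apply: eq_bigr => i _.
by rewrite !hornerE mulrC.
Qed.

Lemma peval_line (R : realType) (p : {mpoly R[2]}) (x v : 'cV[R]_2) :
  exists2 f : {poly R}, (size f <= (pdegree p).+1)%N &
    forall t, f.[t] = peval p (x + t *: v).
Proof.
have [f sf fE] := meval_line R 2 p (fun i => x i 0) (fun i => v i 0).
exists f; first exact: leq_trans sf (leqSpred _).
by move=> t; rewrite fE; apply: meval_eq => i; rewrite !mxE.
Qed.

Lemma convex_functionT_le (R : realType) (E : lmodType R) (g : E -> R)
    (t : R) (x y : E) :
  convex_function setT g -> 0 <= t <= 1 ->
  g (t *: x + (1 - t) *: y) <= t * g x + (1 - t) * g y.
Proof.
move=> cg /andP[t0 t1].
have t01 : Itv.spec (@Itv.num_sem R) (Itv.Real `[0%Z, 1%Z]) t.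
  by apply/andP; split; rewrite ?num_real // /= in_itv /= t0 t1.
by have := cg (Itv.mk t01) x y; apply; rewrite inE.
Qed.

(* Convexity between [g] and [2] bounds the drop from [1] to [g] by
   [(1 - g) * f.[2]]. *)
Lemma convex_ray_lower_bound (R : realType) (p : {mpoly R[2]}) (C g : R)
    (v : 'cV[R]_2) :
  (forall (f : {poly R}) (B : R), 0 <= B -> (size f <= (pdegree p).+1)%N ->
     (forall x, 0 <= x <= 1 -> `|f.[x]| <= B) -> `|f.[2]| <= C * B) ->
  convex_function setT (peval p) -> peval p 0 = 0 ->
  (forall x, 0 <= peval p x) -> 0 <= g <= 1 ->
  (1 - (1 - g) * C) * peval p v <= peval p (g *: v).
Proof.
move=> HC cp p0 pge0 /andP[g0 g1].
have [f sf fE] := peval_line R p 0 v.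
have pE t : peval p (t *: v) = f.[t] by rewrite fE add0r.
have f1 : peval p v = f.[1] by rewrite -pE scale1r.
(* On [0,1], convexity and [p(0) = 0] give [f.[t] <= t * f.[1] <= f.[1]]. *)
have f2 : `|f.[2]| <= C * f.[1].
  apply: HC => //; rewrite -?f1 // => t t01.
  rewrite ger0_norm -pE //.
  have := convex_functionT_le R _ (peval p) t v 0 cp t01.
  rewrite scaler0 addr0 p0 mulr0 addr0; case/andP: t01 => t0 t1 H.
  by apply: le_trans H _; rewrite ler_piMl.
have g2 : 0 < 2 - g by lra.
(* The weight that makes [v] a convex combination of [g *: v] and [2 *: v]. *)
have l01 : 0 <= (2 - g)^-1 <= 1.
  by rewrite invr_ge0 ltW //= invf_le1 //; lra.
have := convex_functionT_le R _ (peval p) (2 - g)^-1 (g *: v) (2 *: v) cp l01.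
have -> : (2 - g)^-1 *: (g *: v) + (1 - (2 - g)^-1) *: (2 *: v) = v.
  rewrite !scalerA -scalerDl -[RHS]scale1r; congr (_ *: _).
  by field; rewrite gt_eqF.
rewrite !pE f1 => H.
have {}H : (2 - g) * f.[1] <= f.[g] + (1 - g) * f.[2].
  have := ler_wpM2l (ltW g2) H; congr (_ <= _).
  by field; rewrite gt_eqF.
have f20 := ler_norm f.[2].
have f1g : 0 <= (1 - g) * f.[1] by rewrite mulr_ge0 -?f1 //; lra.
have : (1 - g) * f.[2] <= (1 - g) * (C * f.[1]).
  by rewrite ler_wpM2l ?(le_trans f20) //; lra.
lra.
Qed.

(** * The action of the two matrices and the resulting bound on [g] *)

Definition vec2 {R : realType} (a b : R) : 'cV[R]_2 :=
  \col_i if i == 0 then a else b.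

Lemma vec2_neq0 (R : realType) (a b : R) : a != 0 -> vec2 a b != 0.
Proof.
by apply: contra_neq => /matrixP /(_ 0 0); rewrite !mxE.
Qed.

Lemma A1_vec2 (R : realType) (a b : R) : A1 R *m vec2 a b = vec2 a a.
Proof.
apply/matrixP => i j; rewrite !mxE !big_ord_recl big_ord0 !mxE /=.
by case: ifP => _; ring.
Qed.

Lemma A2_vec2 (R : realType) (a b : R) : A2 R *m vec2 a b = vec2 b (- b).
Proof.
apply/matrixP => i j; rewrite !mxE !big_ord_recl big_ord0 !mxE /=.
by case: ifP => _; ring.
Qed.

(** With [e = (1 - g) * C] and [a = p(1,1)], the dynamics force [p(1,2) >= 2 * (1 - e)^2 * a], while
    extrapolation along [x = 1] gives [p(1,2) <= a + 2 * e * C * a]. These clash when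
    [e * (4 + 2 * C) < 1]. *)
Lemma lyapunov_gamma_bound (R : realType) (p : {mpoly R[2]}) (C g : R) :
  1 <= C ->
  (forall (f : {poly R}) (B : R), 0 <= B -> (size f <= (pdegree p).+1)%N ->
     (forall x, 0 <= x <= 1 -> `|f.[x]| <= B) -> `|f.[2]| <= C * B) ->
  g < 1 -> common_convex_poly_lyapunov (Mset g) p ->
  1 <= (1 - g) * (C * (4 + 2 * C)).
Proof.
move=> C1 HC g1 [cp p0 ppos pdec].
rewrite leNgt; apply/negP => small.
have pge0 x : 0 <= peval p x.
  by have [->|/ppos/ltW//] := eqVneq x 0; rewrite p0.
set e := (1 - g) * C.
have e0 : 0 <= e by rewrite mulr_ge0 //; lra.
have eC : e * (4 + 2 * C) < 1 by rewrite /e -mulrA.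
have eC0 : 0 <= e * C by rewrite mulr_ge0 //; lra.
(* As [e < 1], this yields [0 <= g], which the ray bound requires. *)
have ge : 1 - g <= e by rewrite /e ler_peMr //; lra.
have eeC : e <= e * C by rewrite ler_peMr.
have g01 : 0 <= g <= 1 by lra.
have ray v := convex_ray_lower_bound R p C g v HC cp p0 pge0 g01.
have dec A x : g *: A \in Mset g -> x != 0 ->
    (1 - e) * peval p (A *m x) <= peval p x.
  move=> AM x0; apply: le_trans (ray _) _.
  by rewrite scalemxAl; apply/ltW/pdec.
clearbody e.
(* Up to the factor [1 - e], [p] is minimal on each vertical line [x != 0] at the diagonal point. *)
have dec1 x y : x != 0 ->
    (1 - e) * peval p (vec2 x x) <= peval p (vec2 x y).
  by move=> x0; rewrite -(A1_vec2 _ x y) dec ?vec2_neq0 // !inE eqxx.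
have dec2 x y : x != 0 ->
    (1 - e) * peval p (vec2 y (- y)) <= peval p (vec2 x y).
  by move=> x0; rewrite -(A2_vec2 _ x y) dec ?vec2_neq0 // !inE eqxx orbT.
have a0 : 0 < peval p (vec2 1 1) by rewrite ppos ?vec2_neq0 ?oner_neq0.
have ba := dec2 1 1 (oner_neq0 _).
have a2 : 2 * peval p (vec2 1 1) <= peval p (vec2 2 2).
  have h01 : 0 <= (2 : R)^-1 <= 1 by lra.
  have := convex_functionT_le R _ (peval p) 2^-1 (vec2 2 2) 0 cp h01.
  rewrite scaler0 addr0 p0.
  have -> : 2^-1 *: vec2 2 2 = vec2 1 1 :> 'cV[R]_2.
    by apply/matrixP => i j; rewrite !mxE; case: ifP => _; field.
  lra.
(* Two moves link (1,2) to the diagonal: [A2] sends it to (2,-2), which [A1] sends to (2,2). *)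
have c2 := dec2 1 2 (oner_neq0 _).
have d2 : (1 - e) * peval p (vec2 2 2) <= peval p (vec2 2 (- 2)).
  by apply: dec1; lra.
move: a0 ba a2 c2 d2.
set a := peval p (vec2 1 1); set b := peval p (vec2 1 (-1)).
set c := peval p (vec2 1 2); set d := peval p (vec2 2 2).
set h := peval p (vec2 2 (-2)) => a0 ba a2 c2 d2.
have [f sf fE] := peval_line R p (vec2 1 0) (vec2 0 1).
have {}fE t : f.[t] = peval p (vec2 1 t).
  rewrite fE; congr peval; apply/matrixP => i j; rewrite !mxE.
  by case: ifP => _; ring.
have b0 : 0 <= b by apply: pge0.
(* Holds because [(1 - e) * (1 + 2 * e) = 1 + e * (1 - 2 * e) >= 1]. *)
have b_le : b <= a + 2 * e * a.
  have e1 : 0 < 1 - e by lra.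
  have ea : 0 <= e * (1 - 2 * e) * a by rewrite !mulr_ge0 //; lra.
  by rewrite -(ler_pM2l e1); lra.
(* The lower bound is [dec1]; the upper one is convexity between (1,1) and (1,-1). *)
have near t : 0 <= t <= 1 -> `|(f - a%:P).[t]| <= 2 * e * a.
  move=> t01; rewrite hornerD hornerN hornerC fE ler_distl.
  have := dec1 1 t (oner_neq0 _); rewrite -/a => lo.
  have s01 : 0 <= (1 + t) / 2 <= 1 by lra.
  have := convex_functionT_le R _ (peval p) ((1 + t) / 2)
    (vec2 1 1) (vec2 1 (-1)) cp s01.
  have -> : ((1 + t) / 2) *: vec2 1 1 + (1 - (1 + t) / 2) *: vec2 1 (-1)
      = vec2 1 t.
    by apply/matrixP => i j; rewrite !mxE; case: ifP => _; field.
  rewrite -/a -/b => up.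
  have ea : 0 <= e * a by rewrite mulr_ge0 // ltW.
  have H2 : (1 - (1 + t) / 2) * b <= (1 - (1 + t) / 2) * (a + 2 * e * a).
    by rewrite ler_wpM2l //; lra.
  have H1 : (1 - (1 + t) / 2) * (e * a) <= e * a by rewrite ler_piMl //; lra.
  by apply/andP; split; lra.
have B0 : 0 <= 2 * e * a by rewrite !mulr_ge0 // ltW.
have sfa : (size (f - a%:P)%R <= (pdegree p).+1)%N.
  apply: leq_trans (size_polyD _ _) _; rewrite geq_max sf size_polyN.
  exact: leq_trans (size_polyC_leq1 _) _.
have := HC _ _ B0 sfa near; rewrite hornerD hornerN hornerC fE -/c ler_distl.
move=> /andP[_ cle].
have c_ge : (1 - e) * ((1 - e) * (2 * a)) <= c.
  apply: le_trans c2; rewrite ler_wpM2l //; first by lra.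
  by apply: le_trans d2; rewrite ler_wpM2l //; lra.
have : (1 - e * (4 + 2 * C)) * a <= 0.
  have : 0 <= e ^+ 2 * a by rewrite mulr_ge0 ?sqr_ge0 // ltW.
  lra.
by rewrite leNgt mulr_gt0 //; lra.
Qed.

Theorem theorem3p6 (R : realType) (D : int) :
  exists2 gamma0 : R, gamma0 < 1 &
    forall gamma : R, gamma0 < gamma -> gamma < 1 ->
      ~ exists2 p : {mpoly R[2]},
          common_convex_poly_lyapunov (Mset gamma) p
          & (pdegree p)%:Z <= D.
Proof.
(* The absolute value turns [D], possibly negative, into a natural size bound. *)
have [C C1 HC] := poly_bound_unit_interval R `|D|%N.+1 2.
have K0 : 0 < C * (4 + 2 * C) by rewrite mulr_gt0 //; lra.
exists (1 - (C * (4 + 2 * C))^-1); first by rewrite gtrBl invr_gt0.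
move=> g g0 g1 [p lp pD].
have := lyapunov_gamma_bound R p C g C1 _ g1 lp.
rewrite leNgt -ltr_pdivlMr // div1r ltrBlDr -ltrBlDl g0 => H.
suff: false by [].
apply: H => f B B0 sf; apply: HC => //; apply: leq_trans sf _.
by rewrite ltnS -lez_nat (le_trans pD) // abszE ler_norm.
Qed.
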